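(* Let $\mathbf{I}$ be the $2\times 2$ identity matrix and $$\mathbf{L}=\begin{pmatrix}1&0\\ 1&1\end{pmatrix},\qquad \mathbf{R}=\begin{pmatrix}1&1\\ 0&1\end{pmatrix},$$ and let $\mathcal{M}$ be the set of all finite products of $\mathbf{L}$ and $\mathbf{R}$. (1) For positive integers $m,n$, consider the following algorithm. Initially set $(x\ \ y):=(m\ \ n)$ and $\mathbf{D}:=\mathbf{I}$. While $x\neq y$: if $y<x$, simultaneously replace $(x\ \ y)$ by $(x\ \ y)\mathbf{L}^{-1}$ and $\mathbf{D}$ by $\mathbf{L}\mathbf{D}$; if $x<y$, simultaneously replace $(x\ \ y)$ by $(x\ \ y)\mathbf{R}^{-1}$ and $\mathbf{D}$ by $\mathbf{R}\mathbf{D}$. This algorithm terminates, and the function that maps the positive rational $\frac{m}{n}$ to the final matrix $\mathbf{D}$ is a well-defined bijection from the positive rationals to $\mathcal{M}$. Its inverse is the function that maps $\mathbf{D}\in\mathcal{M}$ to the positive rational $\frac{p}{q}$, where $(p\ \ q)=(1\ \ 1)\,\mathbf{D}$. Specifically, on termination $(1\ \ 1)\,\mathbf{D}=\left(\frac{m}{\gcd(m,n)}\ \ \frac{n}{\gcd(m,n)}\right)$. (2) For positive integers $m,n$, consider the transposed algorithm. Initially set $\begin{pmatrix}x\\ y\end{pmatrix}:=\begin{pmatrix}m\\ n\end{pmatrix}$ and $\mathbf{D}:=\mathbf{I}$. While $x\neq y$: if $y<x$, simultaneously replace $\begin{pmatrix}x\\ y\end{pmatrix}$ by $\mathbf{R}^{-1}\begin{pmatrix}x\\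 y\end{pmatrix}$ and $\mathbf{D}$ by $\mathbf{D}\mathbf{R}$; if $x<y$, simultaneously replace $\begin{pmatrix}x\\ y\end{pmatrix}$ by $\mathbf{L}^{-1}\begin{pmatrix}x\\ y\end{pmatrix}$ and $\mathbf{D}$ by $\mathbf{D}\mathbf{L}$. This algorithm terminates, and the function that maps the positive rational $\frac{m}{n}$ to the final matrix $\mathbf{D}$ is a well-defined bijection from the positive rationals to $\mathcal{M}$. Its inverse is the function that maps $\mathbf{D}\in\mathcal{M}$ to the positive rational $\frac{p}{q}$, where $\begin{pmatrix}p\\ q\end{pmatrix}=\mathbf{D}\begin{pmatrix}1\\ 1\end{pmatrix}$.
   Context: The finite products of $\mathbf{L}$ and $\mathbf{R}$ include the empty product, which is the identity matrix $\mathbf{I}$. ''Finite products'' means the set of matrices so obtained. *)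

(* Defs.v *)
From mathcomp Require Export all_boot all_order all_algebra.
From mathcomp Require Export classical_sets functions.

Set Implicit Arguments.
Unset Strict Implicit.
Unset Printing Implicit Defensive.

Import GRing.Theory.
Local Open Scope ring_scope.
Local Open Scope classical_set_scope.

Definition row2 (x y : int) : 'rV[int]_2 := \row_j (if j == 0 then x else y).

Definition col2 (x y : int) : 'cV[int]_2 := \col_i (if i == 0 then x else y).

Definition mx2 (a b c d : int) : 'M[int]_2 :=
  \matrix_(i, j) (if i == 0 then if j == 0 then a else b
                  else if j == 0 then c else d).

Definition Lmx : 'M[int]_2 := mx2 1 0
                                  1 1.

Definition Rmx : 'M[int]_2 := mx2 1 1
                                  0 1.

(* [invmx] is the identity on non-units: these two facts make [invmx Lmx] and
   [invmx Rmx] genuine inverses. *)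
Lemma Lmx_unit : Lmx \in unitmx.
Proof.
rewrite unitmxE (expand_det_row _ ord0) !big_ord_recl big_ord0 /cofactor.
by rewrite !det_mx11 !mxE.
Qed.

Lemma Rmx_unit : Rmx \in unitmx.
Proof.
rewrite unitmxE (expand_det_row _ ord0) !big_ord_recl big_ord0 /cofactor.
by rewrite !det_mx11 !mxE.
Qed.

(* The empty sequence yields the identity matrix. *)
Definition LRproducts : set 'M[int]_2 :=
  [set D | exists2 s : seq 'M[int]_2,
     {subset s <= [:: Lmx; Rmx]} & D = \prod_(A <- s) A].

Definition posrat : set rat := [set q | 0 < q].

(* Big-step semantics: [while guard body s t] says that the loop started in [s]
   terminates, in state [t]. *)
Inductive while (S : Type) (guard : S -> bool) (body : S -> S) : S -> S -> Prop :=
| while_stop s : ~~ guard s -> while guard body s s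
| while_loop s t : guard s -> while guard body (body s) t ->
    while guard body s t.

Definition row_state : Type := 'rV[int]_2 * 'M[int]_2.

Definition row_guard (s : row_state) : bool := s.1 0 0 != s.1 0 1.

Definition row_body (s : row_state) : row_state :=
  let: (v, D) := s in
  let x := v 0 0 in let y := v 0 1 in
  if y < x then (v *m invmx Lmx, Lmx *m D)
  else if x < y then (v *m invmx Rmx, Rmx *m D)
  else s.

Definition row_run (m n : nat) (s : row_state) : Prop :=
  while row_guard row_body (row2 m%:Z n%:Z, 1%:M) s.

Definition col_state : Type := 'cV[int]_2 * 'M[int]_2.

Definition col_guard (s : col_state) : bool := s.1 0 0 != s.1 1 0.

Definition col_body (s : col_state) : col_state :=
  let: (v, D) := s in
  let x := v 0 0 in let y := v 1 0 in
  if y < x then (invmx Rmx *m v, D *m Rmx)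
  else if x < y then (invmx Lmx *m v, D *m Lmx)
  else s.

Definition col_run (m n : nat) (s : col_state) : Prop :=
  while col_guard col_body (col2 m%:Z n%:Z, 1%:M) s.

Definition row_rat (D : 'M[int]_2) : rat :=
  let v := row2 1 1 *m D in (v 0 0)%:~R / (v 0 1)%:~R.

Definition col_rat (D : 'M[int]_2) : rat :=
  let v := D *m col2 1 1 in (v 0 0)%:~R / (v 1 0)%:~R.

Definition inverse_bijections (T U : Type) (A : set T) (B : set U)
    (f : T -> U) (g : U -> T) : Prop :=
  [/\ set_bij A B f, set_fun B A g, {in A, cancel f g} & {in B, cancel g f}].

(* Main.v *)
(** Read backwards, the algorithm is a computation of (g g) D: for x, y > 0,
    the vector (x y) L = (x+y  y) has first entry larger than the second, and
    (x y) R = (x  x+y) has it smaller, so the algorithm started at (g g) D,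
    with D a product of L's and R's, strips the factors of D one by one and
    ends with the matrix D. Conversely, (m n) with g = gcd(m,n) has the form
    (g g) D by the subtractive Euclidean algorithm. As the loop is
    deterministic, D is determined by any multiple of (1 1) D, hence by the
    ratio of the entries. Part (2) is part (1) transposed, as R is the
    transpose of L. *)
Require Import Defs.
From mathcomp Require Import zify boolp.

Set Implicit Arguments.
Unset Strict Implicit.
Unset Printing Implicit Defensive.

Import Order.TTheory GRing.Theory Num.Theory.
Local Open Scope ring_scope.
Local Open Scope classical_set_scope.

(** * Determinism and simulation of while loops *)

Lemma while_det (S : Type) (guard : S -> bool) (body : S -> S) (s t u : S) :
  while guard body s t -> while guard body s u -> t = u.
Proof.
move=> w; elim: w u => {s t} [s sF|s t sT _ IH] u w.
  by case: w sF => // {}s v ->.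
by case: w sT IH => [{}s /negPf-> //|{}s v _ w _]; apply.
Qed.

(** Applied with [h] the transposition of both components, in order to transfer runs from one
    algorithm to the other. *)
Lemma while_sim (S T : Type) (gS : S -> bool) (bS : S -> S)
    (gT : T -> bool) (bT : T -> T) (h : S -> T) (s t : S) :
    (forall x, gT (h x) = gS x) -> (forall x, bT (h x) = h (bS x)) ->
  while gS bS s t -> while gT bT (h s) (h t).
Proof.
move=> hg hb; elim=> {s t} [s sF|s t sT _ w]; first by apply: while_stop; rewrite hg.
by apply: while_loop; rewrite ?hg // hb.
Qed.

(** * Two-dimensional vectors, [Lmx] and [Rmx] *)

Lemma row2_mulL (x y : int) : row2 x y *m Lmx = row2 (x + y) y.
Proof.
apply/rowP => j; rewrite mxE !big_ord_recl big_ord0 !mxE addr0 /=.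
by case: j => [[|[|//]] ?] /=; rewrite ?mulr1 ?mulr0 ?add0r.
Qed.

Lemma row2_mulR (x y : int) : row2 x y *m Rmx = row2 x (x + y).
Proof.
apply/rowP => j; rewrite mxE !big_ord_recl big_ord0 !mxE addr0 /=.
by case: j => [[|[|//]] ?] /=; rewrite ?mulr1 ?mulr0 ?addr0.
Qed.

Lemma row2_0 (x y : int) : row2 x y 0 0 = x. Proof. by rewrite mxE. Qed.

Lemma row2_1 (x y : int) : row2 x y 0 1 = y. Proof. by rewrite mxE. Qed.

Lemma scale_row2 (a x y : int) : a *: row2 x y = row2 (a * x) (a * y).
Proof. by apply/rowP => j; rewrite !mxE; case: ifP. Qed.

Lemma trmx_row2 (x y : int) : (row2 x y)^T = col2 x y.
Proof. by apply/colP => i; rewrite !mxE. Qed.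

Lemma trmx_Lmx : Lmx^T = Rmx.
Proof. by apply/matrixP => -[[|[|//]] ?] [[|[|//]] ?]; rewrite !mxE. Qed.

Lemma trmx_Rmx : Rmx^T = Lmx.
Proof. by rewrite -trmx_Lmx trmxK. Qed.

(** * The monoid generated by [Lmx] and [Rmx] *)

Lemma LRproducts1 : LRproducts 1%:M.
Proof. by exists [::]; rewrite ?big_nil. Qed.

Lemma LRproductsM (D E : 'M[int]_2) :
  LRproducts D -> LRproducts E -> LRproducts (D *m E).
Proof.
case=> s sLR -> [t tLR ->]; exists (s ++ t); last by rewrite big_cat.
by move=> A; rewrite mem_cat => /orP[/sLR|/tLR].
Qed.

Lemma LRproductsL : LRproducts Lmx.
Proof.
exists [:: Lmx]; last by rewrite big_seq1.
by move=> A; rewrite !inE => ->.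
Qed.

Lemma LRproductsR : LRproducts Rmx.
Proof.
exists [:: Rmx]; last by rewrite big_seq1.
by move=> A; rewrite !inE => ->; rewrite orbT.
Qed.

(** New factors appear on the right, since the row algorithm strips the rightmost factor first. *)
Lemma LRproducts_ind (P : 'M[int]_2 -> Prop) :
    P 1%:M ->
    (forall D, LRproducts D -> P D -> P (D *m Lmx)) ->
    (forall D, LRproducts D -> P D -> P (D *m Rmx)) ->
  forall D, LRproducts D -> P D.
Proof.
move=> P1 PL PR _ [s sLR ->]; elim/last_ind: s sLR => [|s A IH] sLR.
  by rewrite big_nil.
have tLR : {subset s <= [:: Lmx; Rmx]}.
  by move=> B Bs; apply: sLR; rewrite mem_rcons inE Bs orbT.
have Ps := IH tLR; have Ms : LRproducts (\prod_(A <- s) A) by exists s.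
rewrite big_rcons /= -[_ * A]/(_ *m A).
have: A \in [:: Lmx; Rmx] by apply: sLR; rewrite mem_rcons inE eqxx.
by rewrite !inE => /orP[]/eqP->; [exact: PL|exact: PR].
Qed.

Lemma LRproducts_trmx (D : 'M[int]_2) : LRproducts D -> LRproducts D^T.
Proof.
elim/LRproducts_ind => {D} [|D _ IH|D _ IH].
- by rewrite trmx1; exact: LRproducts1.
- by rewrite trmx_mul trmx_Lmx; apply: LRproductsM => //; exact: LRproductsR.
- by rewrite trmx_mul trmx_Rmx; apply: LRproductsM => //; exact: LRproductsL.
Qed.

(** * Runs of the row algorithm and Euclidean subtraction *)

Lemma row2_mulLR_gt0 (g : int) (D : 'M[int]_2) : 0 < g -> LRproducts D ->
  exists a b : int, [/\ 0 < a, 0 < b & row2 g g *m D = row2 a b].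
Proof.
move=> g0; elim/LRproducts_ind => {D} [|D _ [a [b [a0 b0 e]]]|D _ [a [b [a0 b0 e]]]].
- by exists g, g; rewrite mulmx1.
- by exists (a + b), b; rewrite mulmxA e row2_mulL addr_gt0.
- by exists a, (a + b); rewrite mulmxA e row2_mulR addr_gt0.
Qed.

(** The accumulator [E] is arbitrary for the induction: stripping [Lmx] from [D *m Lmx] leaves [D]
    to be processed with accumulator [Lmx *m E]. *)
Lemma while_row2_mulLR (g : int) (D E : 'M[int]_2) : 0 < g -> LRproducts D ->
  while row_guard row_body (row2 g g *m D, E) (row2 g g, D *m E).
Proof.
move=> g0 MD; elim/LRproducts_ind: MD E => {D} [E|D MD IH E|D MD IH E].
- by rewrite mulmx1 mul1mx; apply: while_stop; rewrite /row_guard row2_0 row2_1 eqxx.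
- have [a [b [a0 b0 e]]] := row2_mulLR_gt0 g0 MD.
  have ab : b < a + b by rewrite ltrDr.
  rewrite mulmxA e; apply: while_loop.
    by rewrite /row_guard row2_mulL row2_0 row2_1 gt_eqF.
  (* The comparison selects the branch of [Lmx]; folding the vector back into a multiple of [Lmx]
     then lets the inverse cancel without being computed. *)
  rewrite /row_body row2_mulL row2_0 row2_1 ab -row2_mulL mulmxK ?Lmx_unit //.
  by rewrite -e -mulmxA.
- have [a [b [a0 b0 e]]] := row2_mulLR_gt0 g0 MD.
  have ab : a < a + b by rewrite ltrDl.
  rewrite mulmxA e; apply: while_loop.
    by rewrite /row_guard row2_mulR row2_0 row2_1 lt_eqF.
  rewrite /row_body row2_mulR row2_0 row2_1 ab ltNge (ltW ab) /=.
  by rewrite -row2_mulR mulmxK ?Rmx_unit // -e -mulmxA.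
Qed.

Lemma row2_gcd_mulLR (m n : nat) : (0 < m)%N -> (0 < n)%N ->
  exists2 D, LRproducts D &
    row2 m%:Z n%:Z = row2 (gcdn m n)%:Z (gcdn m n)%:Z *m D.
Proof.
(* Strong induction on [m + n], which each subtraction decreases. *)
have [k] := ubnP (m + n)%N; elim: k m n => // k IH m n mnk m0 n0.
case: (ltngtP m n) => [mn|nm|<-]; last first.
- by exists 1%:M; [exact: LRproducts1|rewrite mulmx1 gcdnn].
- have [|||D MD e] := IH (m - n)%N n; try lia.
  exists (D *m Lmx); first by apply: LRproductsM => //; exact: LRproductsL.
  have -> : gcdn m n = gcdn (m - n) n.
    by rewrite -{1}(subnK (ltnW nm)) gcdnC gcdnDr gcdnC.
  by rewrite mulmxA -e row2_mulL -PoszD subnK // ltnW.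
- have [|||D MD e] := IH m (n - m)%N; try lia.
  exists (D *m Rmx); first by apply: LRproductsM => //; exact: LRproductsR.
  have -> : gcdn m n = gcdn m (n - m) by rewrite -{1}(subnKC (ltnW mn)) gcdnDl.
  by rewrite mulmxA -e row2_mulR -PoszD subnKC // ltnW.
Qed.

(** * The ratio of the entries as a bijection *)

Lemma row_ratE (g : int) (D : 'M[int]_2) : g != 0 ->
  row_rat D = ((row2 g g *m D) 0 0)%:~R / ((row2 g g *m D) 0 1)%:~R.
Proof.
move=> g0; have -> : row2 g g = g *: row2 1 1 by rewrite scale_row2 mulr1.
rewrite -scalemxAl /row_rat; set w := _ *m D.
have scE j : (g *: w) 0 j = g * w 0 j by rewrite mxE.
by rewrite !scE !intrM -mulf_div divff ?mul1r ?intr_eq0.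
Qed.

Lemma row_rat_gt0 (D : 'M[int]_2) : LRproducts D -> 0 < row_rat D.
Proof.
move=> /(row2_mulLR_gt0 ltr01)[a [b [a0 b0 e]]].
by rewrite /row_rat e row2_0 row2_1 divr_gt0 // ltr0z.
Qed.

Lemma row_rat_inj : {in LRproducts &, injective row_rat}.
Proof.
move=> D E /set_mem MD /set_mem ME.
have [a [b [a0 b0 eD]]] := row2_mulLR_gt0 ltr01 MD.
have [c [d [c0 d0 eE]]] := row2_mulLR_gt0 ltr01 ME.
rewrite /row_rat eD eE !row2_0 !row2_1 => /eqP.
rewrite eqr_div ?intr_eq0 ?(gt_eqF b0) ?(gt_eqF d0) // -!intrM eqr_int => /eqP e.
(* Cross-multiplication gave [a * d = c * b], so scaling by [d] and by [b] makes the two vectors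
   agree. *)
have eqDE : row2 d d *m D = row2 b b *m E.
  rewrite -[d]mulr1 -[b]mulr1 -!scale_row2 -!scalemxAl eD eE !scale_row2.
  by rewrite [d * a]mulrC [b * d]mulrC e [c * b]mulrC.
(* Two runs from this common vector end with the matrices [D] and [E]; determinism identifies
   them. *)
have wD := while_row2_mulLR 1%:M d0 MD; rewrite eqDE in wD.
by have [_] := while_det wD (while_row2_mulLR 1%:M b0 ME); rewrite !mulmx1.
Qed.

(** The Euclidean factorization provides one run of the right shape, and determinism makes any other
    run equal to it. *)
Lemma row_runP (m n : nat) (v : 'rV[int]_2) (D : 'M[int]_2) :
    (0 < m)%N -> (0 < n)%N ->
  row_run m n (v, D) <->
  [/\ LRproducts D, v = row2 (gcdn m n)%:Z (gcdn m n)%:Z & v *m D = row2 m n].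
Proof.
move=> m0 n0; have g0 : (0 < (gcdn m n)%:Z :> int) by rewrite ltz_nat gcdn_gt0 m0.
split=> [run|[MD -> e]].
  have [E ME e] := row2_gcd_mulLR m0 n0.
  have wE := while_row2_mulLR 1%:M g0 ME; rewrite -e mulmx1 in wE.
  by have [-> ->] := while_det run wE.
by have := while_row2_mulLR 1%:M g0 MD; rewrite e mulmx1.
Qed.

Lemma row_run_ex (m n : nat) : (0 < m)%N -> (0 < n)%N ->
  exists v, exists2 D, LRproducts D & row_run m n (v, D).
Proof.
move=> m0 n0; have [D MD e] := row2_gcd_mulLR m0 n0.
by exists (row2 (gcdn m n) (gcdn m n)), D => //; apply/row_runP.
Qed.

Lemma row_run_rat (m n : nat) (v : 'rV[int]_2) (D : 'M[int]_2) :
    (0 < m)%N -> (0 < n)%N ->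
  row_run m n (v, D) -> row_rat D = m%:R / n%:R.
Proof.
move=> m0 n0 /row_runP[]// MD -> e.
rewrite (@row_ratE (gcdn m n)) ?e ?row2_0 ?row2_1 //.
by rewrite eqz_nat -lt0n gcdn_gt0 m0.
Qed.

Lemma posrat_frac (q : rat) : posrat q ->
  exists m n : nat, [/\ (0 < m)%N, (0 < n)%N & q = m%:R / n%:R].
Proof.
rewrite /posrat /= => q0; exists `|numq q|%N, `|denq q|%N.
rewrite !absz_gt0 denq_neq0 numq_eq0 (gt_eqF q0); split=> //.
rewrite -[LHS]divq_num_den -[in LHS](gtz0_abs (denq_gt0 q)).
by rewrite -[in LHS](@gtz0_abs (numq q)) ?numq_gt0.
Qed.

Lemma row_rat_bij : set_bij LRproducts posrat row_rat.
Proof.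
split=> [D|D E|q /posrat_frac[m [n [m0 n0 ->]]]].
- exact: row_rat_gt0.
- exact: row_rat_inj.
have [v [D MD run]] := row_run_ex m0 n0.
by exists D => //; exact: row_run_rat run.
Qed.

(** * Inverse bijections and transposition *)

Lemma inverse_bijections_pinv (T U : Type) (u : U) (A : set T) (B : set U)
    (g : U -> T) :
  set_bij B A g -> inverse_bijections A B ('pinv_(fun=> u) B g) g.
Proof.
move=> gbij; split; first exact: (bijpinv_bij (fun=> u) gbij).
- by case: gbij.
- by apply: surjpK; case: gbij.
- by apply: pinvKV; case: gbij.
Qed.

(** Transposition is an involution that preserves the set of products. *)
Lemma inverse_bijections_trmx (A : set rat) (f : rat -> 'M[int]_2)
    (g : 'M[int]_2 -> rat) :
  inverse_bijections A LRproducts f g ->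
  inverse_bijections A LRproducts (fun q => (f q)^T) (fun D => g D^T).
Proof.
case=> -[ffun finj fsurj] gfun fK gK; split; first split.
- by move=> q Aq; apply/LRproducts_trmx/ffun.
- by move=> q r Aq Ar /trmx_inj; exact: finj.
- move=> D /LRproducts_trmx/fsurj[q Aq e].
  by exists q => //; rewrite e trmxK.
- by move=> D /LRproducts_trmx; exact: gfun.
- by move=> q Aq; rewrite trmxK fK.
- move=> D /set_mem/LRproducts_trmx MD.
  by rewrite gK ?trmxK //; exact: mem_set.
Qed.

Lemma col_rat_trmx : col_rat = fun D => row_rat D^T.
Proof.
apply/funext => D; rewrite /col_rat /row_rat.
have -> : row2 1 1 *m D^T = (D *m col2 1 1)^T by rewrite trmx_mul -trmx_row2 trmxK.
by rewrite !mxE.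
Qed.

Lemma col_guard_trmx (s : row_state) : col_guard (s.1^T, s.2^T) = row_guard s.
Proof. by rewrite /col_guard /row_guard /= !mxE. Qed.

Lemma col_body_trmx (s : row_state) :
  col_body (s.1^T, s.2^T) = ((row_body s).1^T, (row_body s).2^T).
Proof.
case: s => v D; rewrite /col_body /row_body /=.
have vT i : v^T i 0 = v 0 i by rewrite mxE.
rewrite !vT; case: ifP => _ /=; first by rewrite !trmx_mul trmx_inv trmx_Lmx.
by case: ifP => _ //=; rewrite !trmx_mul trmx_inv trmx_Rmx.
Qed.

Lemma col_run_trmx (m n : nat) (v : 'cV[int]_2) (D : 'M[int]_2) :
  col_run m n (v, D) <-> row_run m n (v^T, D^T).
Proof.
rewrite /col_run /row_run; split=> run.
  have -> : (row2 m n, 1%:M) = ((col2 m n)^T, (1%:M)^T) :> row_state.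
    by rewrite -trmx_row2 trmxK trmx1.
  apply: (@while_sim _ _ _ _ _ _ (fun s : col_state => (s.1^T, s.2^T)) _ _ _ _ run).
    by case=> w E; rewrite -col_guard_trmx /= !trmxK.
  case=> w E; have := col_body_trmx (w^T, E^T); rewrite /= !trmxK => ->.
  by rewrite /= !trmxK -surjective_pairing.
have -> : (col2 m n, 1%:M) = ((row2 m n)^T, (1%:M)^T) :> col_state.
  by rewrite trmx_row2 trmx1.
have := while_sim col_guard_trmx col_body_trmx run.
by rewrite /= !trmxK.
Qed.

Theorem theorem31 :
  ([/\ forall m n : nat, (0 < m)%N -> (0 < n)%N ->
         exists s : row_state, row_run m n s,
       exists f : rat -> 'M[int]_2,
         (forall m n : nat, (0 < m)%N -> (0 < n)%N ->
            forall D : 'M[int]_2,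
              (exists v : 'rV[int]_2, row_run m n (v, D))
              <-> D = f (m%:R / n%:R))
         /\ inverse_bijections posrat LRproducts f row_rat
     & forall m n : nat, (0 < m)%N -> (0 < n)%N ->
         forall (v : 'rV[int]_2) (D : 'M[int]_2), row_run m n (v, D) ->
           row2 1 1 *m D = row2 (m %/ gcdn m n)%N%:Z (n %/ gcdn m n)%N%:Z])
  /\
  ((forall m n : nat, (0 < m)%N -> (0 < n)%N ->
      exists s : col_state, col_run m n s)
   /\ exists f : rat -> 'M[int]_2,
        (forall m n : nat, (0 < m)%N -> (0 < n)%N ->
           forall D : 'M[int]_2,
             (exists v : 'cV[int]_2, col_run m n (v, D))
             <-> D = f (m%:R / n%:R))
        /\ inverse_bijections posrat LRproducts f col_rat).
Proof.
(* The map [f] is taken as the inverse of [row_rat], with value the identity off its image; [fP]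
   then shows that the algorithm computes it. *)
pose f := 'pinv_(fun=> 1%:M) LRproducts row_rat.
have fbij : inverse_bijections posrat LRproducts f row_rat.
  exact/inverse_bijections_pinv/row_rat_bij.
have fP m n : (0 < m)%N -> (0 < n)%N -> forall D,
    (exists v, row_run m n (v, D)) <-> D = f (m%:R / n%:R).
  move=> m0 n0 D; case: (fbij) => _ _ _ fK.
  have [v [E ME run]] := row_run_ex m0 n0.
  (* Writing the fraction as [row_rat E], with [E] the result of an actual run, turns its image
     under [f] into [E]. *)
  rewrite -(row_run_rat m0 n0 run) fK; last exact: mem_set.
  split=> [[w run']|->]; last by exists v.
  by have [] := while_det run run'.
split; first split.
- by move=> m n m0 n0; have [v [D _ run]] := row_run_ex m0 n0; exists (v, D).
- by exists f.
- move=> m n m0 n0 v D /row_runP[]// _ -> e.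
  set g := gcdn m n in e *.
  have g0 : g%:Z != 0 by rewrite eqz_nat -lt0n gcdn_gt0 m0.
  (* After multiplication by the gcd, both sides become the initial vector. *)
  apply/rowP => j; apply: (mulfI g0).
  have scE (w : 'rV[int]_2) : g%:Z * w 0 j = (g%:Z *: w) 0 j by rewrite mxE.
  rewrite !scE scalemxAl !scale_row2 mulr1 e -!PoszM.
  by rewrite !(mulnC g) !divnK ?dvdn_gcdl ?dvdn_gcdr.
split=> [m n m0 n0|].
  have [v [D _ run]] := row_run_ex m0 n0; exists (v^T, D^T).
  by apply/col_run_trmx; rewrite !trmxK.
exists (fun q => (f q)^T); split; last first.
  by rewrite col_rat_trmx; exact: inverse_bijections_trmx.
move=> m n m0 n0 D; split=> [[v /col_run_trmx run]|->].
  (* The transpose of [D] results from a row run, so [fP] applies to it. *)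
  by apply: (can_inj trmxK); rewrite trmxK; apply/fP => //; exists v^T.
have [v run] := (fP m n m0 n0 _).2 (erefl _).
by exists v^T; apply/col_run_trmx; rewrite !trmxK.
Qed.
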